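(* Assume that $T$ is a unilateral shift, that $\dim\ker\bar\omega\le\dim\ker\bar\omega^*$, and that $D_X$ and $D_XT$ both have closed range. Let $R_0\in\mathcal L(\ker\bar\omega,\ker\bar\omega^* )$ be any isometry, define the free Schur contraction by $R(z)=R_0$ $(z\in\mathbb D)$, and let $Y$ be the corresponding contractive intertwining lifting of $X$. Then $Y$ is an isometry.
   Context: All Hilbert spaces are complex and separable; $\mathbb D$ is the open unit disc. For a contraction $C$, $D_C=(I-C^*C)^{1/2}$ and $\mathcal D_C$ is the closure of the range of $D_C$. $H^2(\mathcal E)$ is the Hardy space of $\mathcal E$-valued functions on $\mathbb D$. Setting: $T'\in\mathcal L(\mathcal H')$ is a completely nonunitary contraction, $T\in\mathcal L(\mathcal H)$ is an isometry, $X\in\mathcal L(\mathcal H,\mathcal H')$ satisfies $T'X=XT$, $\|X\|\le1$. The minimal isometric lifting of $T'$ is $U'$ on $\mathcal K'=\mathcal H'\oplus H^2(\mathcal D_{T'})$, $U'(h'\oplus f)=T'h'\oplus(D_{T'}h'+zf(z))$; $P'$ is the orthogonal projection of $\mathcal K'$ onto $\mathcal H'$. A contractive intertwining lifting of $X$ is $Y\in\mathcal L(\mathcal H,\mathcal K')$ with $U'Y=YT$, $P'Y=X$, $\|Y\|\le1$. The isometry $\omega:(D_XT\mathcal H)^-\to\{D_{T'}Xh\oplus D_Xh:h\in\mathcal H\}^-\subset\mathcal D_{T'}\oplus\mathcal D_X$ is the continuous extension of $D_XTh\mapsto D_{T'}Xh\oplus D_Xh$. The partial isometry $\bar\omega\in\mathcal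 L(\mathcal D_X,\mathcal D_{T'}\oplus\mathcal D_X)$ equals $\omega$ on $(D_XT\mathcal H)^-$ and $0$ on $\mathcal D_X\ominus(D_XT\mathcal H)^-$. The operators $\Pi',\Pi$ on $\mathcal D_{T'}\oplus\mathcal D_X$ are $\Pi'(d'\oplus d)=d'\in\mathcal D_{T'}$, $\Pi(d'\oplus d)=d\in\mathcal D_X$. A free Schur contraction is an analytic function $R(z)\in\mathcal L(\ker\bar\omega,\ker\bar\omega^* )$ with $\|R(z)\|\le1$ $(z\in\mathbb D)$. With $W(z)=\bar\omega+R(z)(I-\bar\omega^*\bar\omega)$ and $\Gamma(z)=\Pi'W(z)(I-z\Pi W(z))^{-1}$, the corresponding contractive intertwining lifting is $Yh=Xh\oplus\Gamma(\cdot)D_Xh$ $(h\in\mathcal H)$. *)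

(* Defs.v *)
From HB Require Import structures.
From mathcomp Require Import all_boot all_order all_algebra.
From mathcomp Require Import complex.
From mathcomp Require Import all_classical all_reals all_analysis.

Set Implicit Arguments.
Unset Strict Implicit.
Unset Printing Implicit Defensive.

Import Order.TTheory GRing.Theory Num.Theory numFieldNormedType.Exports.

Local Open Scope classical_set_scope.
Local Open Scope ring_scope.

(* Inner products are linear in the first argument and conjugate-linear in the
   second one.  Pre-Hilbert spaces carry no topology of their own: the norm that
   the library puts on a product of normed modules is the max norm, so norms of
   elements of a direct sum are always measured with [hnorm] below. *)
HB.mixin Record hasInner (R : realType) V of GRing.Lmodule R[i] V := {
  inner : {dot V for (@Num.conj R[i])}
}.

#[short(type="prehilbertType")]
HB.structure Definition PreHilbert (R : realType) :=
  {V of hasInner R V & GRing.Lmodule R[i] V}.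

HB.mixin Record isHilbert (R : realType) H
    of PreHilbert R H & CompleteNormedModule R[i] H := {
  norm_inner : forall x : H, `|x| ^+ 2 = inner x x;
  countable_dense : exists A : set H, countable A /\ dense A
}.

#[short(type="hilbertType")]
HB.structure Definition Hilbert (R : realType) :=
  {H of isHilbert R H & PreHilbert R H & CompleteNormedModule R[i] H}.

Section DirectSum.
Context {R : realType} {U V : prehilbertType R}.

Definition dsum_inner (u v : U * V) : R[i] := inner u.1 v.1 + inner u.2 v.2.

Let dsum_inner_bilinear :
  bilinear_for *%R (@Num.conj R[i] \; *%R) dsum_inner.
Proof.
split=> [v|u] a x y; rewrite /dsum_inner /=.
- by rewrite !linearPl mulrDr addrACA.
- by rewrite !linearPr /= mulrDr addrACA.
Qed.

HB.instance Definition _ := @bilinear_isBilinear.Build R[i] (U * V)%type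
  (U * V)%type R[i] *%R (@Num.conj R[i] \; *%R) dsum_inner dsum_inner_bilinear.

Let dsum_inner_hermitian (u v : U * V) :
  dsum_inner u v = (-1) ^+ false * Num.conj (dsum_inner v u).
Proof.
rewrite expr0 mul1r /dsum_inner rmorphD /=.
by congr (_ + _); rewrite [LHS]hermC expr0 mul1r.
Qed.

HB.instance Definition _ := @isHermitianSesquilinear.Build R[i] (U * V)%type
  false Num.conj dsum_inner dsum_inner_hermitian.

Let dsum_inner_gt0 (u : U * V) : u != 0 -> 0 < dsum_inner u u.
Proof.
case: u => x y; rewrite /dsum_inner /= -pair_eqE /= negb_and => /orP[] u0.
- by rewrite ltr_wpDr ?dnorm_ge0 // dnorm_gt0.
- by rewrite ltr_wpDl ?dnorm_ge0 // dnorm_gt0.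
Qed.

HB.instance Definition _ := @isDotProduct.Build R[i] (U * V)%type
  dsum_inner dsum_inner_gt0.

HB.instance Definition _ := @hasInner.Build R (U * V)%type
  (dsum_inner : {dot (U * V)%type for Num.conj}).

End DirectSum.

Section Subspaces.
Context {R : realType}.
Implicit Types U V : prehilbertType R.

Definition hnorm {V} (x : V) : R := Num.sqrt (complex.Re (inner x x)).

Definition orth {V} (M : set V) : set V :=
  [set x | forall y, M y -> inner x y = 0].

Definition linear_span {V} (A : set V) : set V :=
  [set x | exists (n : nat) (c : 'I_n -> R[i]) (v : 'I_n -> V),
     (forall i, A (v i)) /\ x = \sum_i c i *: v i].

Definition closed_subspace {H : hilbertType R} (M : set H) : Prop :=
  [/\ closed M, M 0 & forall a x y, M x -> M y -> M (a *: x + y)].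

(* An operator between subspaces is represented by a function between the
   ambient spaces; its values outside the domain [D] are irrelevant. *)
Definition bounded_operator {U V} (D : set U) (E : set V) (f : U -> V) : Prop :=
  [/\ set_fun D E f,
      forall a x y, D x -> D y -> f (a *: x + y) = a *: f x + f y
    & exists C : R, forall x, D x -> hnorm (f x) <= C * hnorm x].

Definition isometric_on {U V} (D : set U) (f : U -> V) : Prop :=
  forall x, D x -> hnorm (f x) = hnorm x.

Definition contractive {U V} (f : U -> V) : Prop :=
  forall x, hnorm (f x) <= hnorm x.

(* [g] is the adjoint of [f], as operators between [D] and [E]. *)
Definition adjoint_on {U V} (D : set U) (E : set V)
    (f : U -> V) (g : V -> U) : Prop :=
  bounded_operator E D g /\
  forall x y, D x -> E y -> inner (f x) y = inner x (g y).

Definition ker_on {U V} (D : set U) (f : U -> V) : set U :=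
  [set x | D x /\ f x = 0].

Definition range_closure {H K : hilbertType R} (f : H -> K) : set K :=
  closure (range f).

Definition orthonormal_basis {V} (M B : set V) : Prop :=
  [/\ B `<=` M,
      forall x y, B x -> B y -> inner x y = (x == y)%:R
    & forall x, M x -> (forall b, B b -> inner x b = 0) -> x = 0].

(* The dimension of a subspace is the cardinality of an orthonormal basis. *)
Definition dim_le {U V} (M : set U) (N : set V) : Prop :=
  exists (A : set U) (B : set V),
    [/\ orthonormal_basis M A, orthonormal_basis N B & (A #<= B)%card].

End Subspaces.

Section Operators.
Context {R : realType} {H K : hilbertType R}.

(* [D] is the positive square root of [I - C^* C]. *)
Definition defect_operator (C : H -> K) (D : H -> H) : Prop :=
  [/\ bounded_operator setT setT D, forall x, 0 <= inner (D x) x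
    & exists2 Cs : K -> H, adjoint_on setT setT C Cs &
        forall x, D (D x) = x - Cs (C x)].

Definition reduces (T : H -> H) (M : set H) : Prop :=
  [/\ closed_subspace M, set_fun M M T & set_fun (orth M) (orth M) T].

Definition completely_nonunitary (T : H -> H) : Prop :=
  forall M, reduces T M -> isometric_on M T -> T @` M = M -> M = [set 0].

(* A unilateral shift of arbitrary multiplicity, given by its wandering
   subspace [L]. *)
Definition unilateral_shift (T : H -> H) : Prop :=
  isometric_on setT T /\
  exists L : set H,
    [/\ closed_subspace L,
        forall m n x y, m <> n -> L x -> L y ->
          inner (iter m T x) (iter n T y) = 0
      & closure (linear_span (\bigcup_n (iter n T @` L))) = setT].

End Operators.

Section Hardy.
Context {R : realType} {E : hilbertType R}.

Definition disc := {z : R[i] | `|z| < 1}.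

Definition taylor_coefs (f : disc -> E) (a : nat -> E) : Prop :=
  forall z : disc, series (fun n => val z ^+ n *: a n) @ \oo --> f z.

(* The space [H^2] of functions on the disc with values in the subspace [D]. *)
Definition hardy2 (D : set E) : set (disc -> E) :=
  [set f | exists a : nat -> E,
     [/\ forall n, D (a n), cvgn (series (fun n => hnorm (a n) ^+ 2))
       & taylor_coefs f a]].

Definition hardy2_norm (f : disc -> E) : R :=
  let a := xget (fun=> 0) [set a | taylor_coefs f a] in
  Num.sqrt (limn (series (fun n => hnorm (a n) ^+ 2))).

End Hardy.
Arguments disc : clear implicits.

Section CommutantLifting.
Context {R : realType} {H H' : hilbertType R}.

Section IsometricLifting.
Variables (T' DT' : H' -> H').

(* The minimal isometric lifting of [T'] acts on [H' (+) H^2(D_T')]; the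
   ambient type is [H' * (disc R -> H')]. *)
Definition lifting_space : set (H' * (disc R -> H')) :=
  [set k | hardy2 (range_closure DT') k.2].

Definition lifting_norm (k : H' * (disc R -> H')) : R :=
  Num.sqrt (hnorm k.1 ^+ 2 + hardy2_norm k.2 ^+ 2).

Definition isometric_lifting (k : H' * (disc R -> H')) : H' * (disc R -> H') :=
  (T' k.1, fun z => DT' k.1 + val z *: k.2 z).

Definition contractive_intertwining_lifting
    (T : H -> H) (X : H -> H') (Y : H -> H' * (disc R -> H')) : Prop :=
  [/\ forall h, lifting_space (Y h),
      forall a h k, Y (a *: h + k) = a *: Y h + Y k,
      forall h, lifting_norm (Y h) <= hnorm h,
      forall h, isometric_lifting (Y h) = Y (T h)
    & forall h, (Y h).1 = X h].

End IsometricLifting.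

Variables (T : H -> H) (X : H -> H') (DT' : H' -> H') (DX : H -> H).

Let dom := range_closure DX.
Let cod := range_closure DT' `*` range_closure DX.

Definition is_omega (om : H -> H' * H) : Prop :=
  {within range_closure (DX \o T), continuous om} /\
  forall h, om (DX (T h)) = (DT' (X h), DX h).

Definition is_omega_bar (om wb : H -> H' * H) : Prop :=
  [/\ bounded_operator dom cod wb,
      forall d, range_closure (DX \o T) d -> wb d = om d
    & forall d, dom d -> orth (range_closure (DX \o T)) d -> wb d = 0].

Variables (wb : H -> H' * H) (wbs : H' * H -> H).
(* [S] is the free Schur contraction. *)
Variable (S : disc R -> H -> H' * H).

Definition schur_W (z : disc R) (d : H) : H' * H :=
  wb d + S z (d - wbs (wb d)).

(* The inverse of [I - z Pi W(z)] is taken in [L(D_X)]. *)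
Definition schur_Gamma (z : disc R) (d : H) : H' :=
  (schur_W z
    ('pinv_(fun=> 0) dom (fun g => g - val z *: (schur_W z g).2) d)).1.

Definition corresponding_lifting (h : H) : H' * (disc R -> H') :=
  (X h, fun z => schur_Gamma z (DX h)).

End CommutantLifting.

(* Main.v *)
Require Import Defs.
From mathcomp Require Import all_boot all_order all_algebra.
From mathcomp Require Import complex.
From mathcomp Require Import all_classical all_reals all_analysis.
From mathcomp Require Import ring lra.
Import Order.TTheory GRing.Theory Num.Theory numFieldNormedType.Exports.
Import ComplexField.Normc.
Local Open Scope classical_set_scope.
Local Open Scope ring_scope.

(** Write [A], [B] for the two components of the constant function [W(z)].  The
    isometry [R_0] makes [d |-> (A d, B d)] isometric on [D_X], and
    [Gamma(z) d = \sum_n z^n A B^n d], so that the squared [H^2]-norm of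
    [Gamma d] telescopes to [|d|^2 - lim |B^N d|^2], and
    [|Y h|^2 = |h|^2 - lim |B^N D_X h|^2].  Everything thus rests on [B^N -> 0]
    strongly on [D_X].  From [B D_X T = D_X] we get [B^N D_X T^N = D_X], hence,
    with [h := D_X B^N d],
      [|D_X B^N d|^2 = <B^N d, D_X h> = <B^N d, B^N D_X T^N h>].
    The forms [<B^N _, B^N _>] decrease with [N], so this is close, uniformly in
    [N >= m], to [<B^m d, B^m D_X T^N h>], a bounded functional of [T^N h]; such
    functionals are small because [T] is a shift.  So [D_X B^N d -> 0], and
    [D_X] is bounded below on its closed range. *)

Set Implicit Arguments.
Unset Strict Implicit.
Unset Printing Implicit Defensive.
Local Open Scope complex_scope.

(** Evaluate at the vertex [t = - b / c]; if [c = 0], the form is affine and is bounded below only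
    when [b = 0]. Allowing [c = 0] gives Cauchy-Schwarz for forms that are merely semidefinite. *)
Lemma quadratic_ge0_discr (R : realType) (a b c : R) : 0 <= c ->
  (forall t, 0 <= a + 2 * b * t + c * t ^+ 2) -> b ^+ 2 <= a * c.
Proof.
rewrite le_eqVlt => /predU1P[<-|c0] h.
  rewrite mulr0; have [->|b0] := eqVneq b 0; first by rewrite expr0n.
  have := h (- (a + 1) / (2 * b)); rewrite mul0r addr0.
  have -> : a + 2 * b * (- (a + 1) / (2 * b)) = -1 by field.
  by rewrite lerNr oppr0 ler10.
have := h (- b / c).
have -> : a + 2 * b * (- b / c) + c * (- b / c) ^+ 2 = (a * c - b ^+ 2) / c.
  by field; rewrite gt_eqF.
by rewrite pmulr_lge0 ?invr_gt0// subr_ge0.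
Qed.

(** * Real part of the inner product, Cauchy-Schwarz and the norm *)

Section InnerProduct.
Context {R : realType} {V : prehilbertType R}.
Implicit Types x y z : V.

(** The real part carries the order needed for estimates and determines the norm; complex
    orthogonality is recovered from it in [orth_rinner]. *)
Definition rinner x y : R := complex.Re (inner x y).

Lemma rinnerC x y : rinner x y = rinner y x.
Proof.
rewrite /rinner (hermC inner x y) expr0 mul1r.
have ReJ (z : R[i]) : complex.Re (Num.conj z) = complex.Re z by case: z.
exact: ReJ.
Qed.

Lemma rinnerDl x y z : rinner (x + y) z = rinner x z + rinner y z.
Proof. by rewrite /rinner linearDl raddfD. Qed.

Lemma rinnerDr x y z : rinner z (x + y) = rinner z x + rinner z y.
Proof. by rewrite /rinner linearDr raddfD. Qed.

Lemma rinnerNl x z : rinner (- x) z = - rinner x z.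
Proof. by rewrite /rinner linearNl raddfN. Qed.

Lemma rinnerNr x z : rinner z (- x) = - rinner z x.
Proof. by rewrite /rinner linearNr raddfN. Qed.

Lemma rinnerBl x y z : rinner (x - y) z = rinner x z - rinner y z.
Proof. by rewrite rinnerDl rinnerNl. Qed.

Lemma rinnerBr x y z : rinner z (x - y) = rinner z x - rinner z y.
Proof. by rewrite rinnerDr rinnerNr. Qed.

Lemma innerZl (a : R[i]) x y : inner (a *: x) y = a * inner x y.
Proof. by rewrite linearZl_LR. Qed.

Lemma innerZr (a : R[i]) x y : inner x (a *: y) = a^* * inner x y.
Proof. by rewrite linearZr_LR. Qed.

Lemma rinnerZl (a : R) x y : rinner (a%:C *: x) y = a * rinner x y.
Proof.
by rewrite /rinner innerZl; case: (inner x y) => u v /=; rewrite mul0r subr0.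
Qed.

Lemma rinnerZr (a : R) x y : rinner x (a%:C *: y) = a * rinner x y.
Proof. by rewrite rinnerC rinnerZl rinnerC. Qed.

Lemma rinner0l x : rinner 0 x = 0.
Proof. by rewrite /rinner linear0l. Qed.

Lemma rinner_ge0 x : 0 <= rinner x x.
Proof. by rewrite /rinner -ler0c RRe_real ?ger0_real// dnorm_ge0. Qed.

Lemma innerxx x : inner x x = (rinner x x)%:C.
Proof. by rewrite /rinner RRe_real// ger0_real// dnorm_ge0. Qed.

Lemma sqr_hnorm x : hnorm x ^+ 2 = rinner x x.
Proof. by rewrite /hnorm sqr_sqrtr// rinner_ge0. Qed.

Lemma hnorm_ge0 x : 0 <= hnorm x.
Proof. exact: sqrtr_ge0. Qed.

Lemma hnorm_eq0 x : (hnorm x == 0) = (x == 0).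
Proof.
apply/eqP/eqP => [x0|->]; last by rewrite /hnorm linear0l sqrtr0.
apply/eqP; rewrite -(dnorm_eq0 inner) innerxx -sqr_hnorm x0.
by rewrite expr0n.
Qed.

Lemma hnorm0 : hnorm (0 : V) = 0.
Proof. by apply/eqP; rewrite hnorm_eq0. Qed.

Lemma hnorm_le_sqr x (C : R) : 0 <= C -> hnorm x ^+ 2 <= C ^+ 2 -> hnorm x <= C.
Proof. by move=> C0; rewrite ler_pXn2r ?nnegrE ?hnorm_ge0. Qed.

Lemma rinner_le x y : `|rinner x y| <= hnorm x * hnorm y.
Proof.
rewrite -(@ler_pXn2r _ 2) ?nnegrE ?mulr_ge0 ?hnorm_ge0// -normrX ger0_norm ?sqr_ge0//.
rewrite exprMn !sqr_hnorm; apply: quadratic_ge0_discr => [|t]; first exact: rinner_ge0.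
have := rinner_ge0 (x + t%:C *: y).
rewrite !(rinnerDl, rinnerDr, rinnerZl, rinnerZr) (rinnerC y x).
by congr (_ <= _); ring.
Qed.

Lemma rinner_ler x y : rinner x y <= hnorm x * hnorm y.
Proof. exact: le_trans (ler_norm _) (rinner_le x y). Qed.

Lemma hnorm_triangle x y : hnorm (x + y) <= hnorm x + hnorm y.
Proof.
apply: hnorm_le_sqr; first by rewrite addr_ge0 ?hnorm_ge0.
rewrite sqr_hnorm sqrrD !sqr_hnorm !(rinnerDl, rinnerDr) (rinnerC y x).
by have := rinner_ler x y; lra.
Qed.

Lemma hnorm_opp x : hnorm (- x) = hnorm x.
Proof. by rewrite /hnorm linearNl linearNr opprK. Qed.

Lemma hnorm_triangleB x y : hnorm (x - y) <= hnorm x + hnorm y.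
Proof. by rewrite -(hnorm_opp y) hnorm_triangle. Qed.

Lemma hdistC x y : hnorm (x - y) = hnorm (y - x).
Proof. by rewrite -hnorm_opp opprB. Qed.

Lemma hnorm_split y x z : hnorm (x - z) <= hnorm (x - y) + hnorm (y - z).
Proof. by have := hnorm_triangle (x - y) (y - z); rewrite addrA subrK. Qed.

Lemma hnormZ (a : R[i]) x : hnorm (a *: x) = normc a * hnorm x.
Proof.
apply/eqP; rewrite -(@eqrXn2 _ 2)// ?mulr_ge0 ?hnorm_ge0//; last first.
  by case: a => u v; exact: sqrtr_ge0.
rewrite exprMn !sqr_hnorm /rinner innerZl innerZr innerxx.
case: a => u v /=; rewrite sqr_sqrtr ?addr_ge0 ?sqr_ge0//.
by apply/eqP; rewrite /=; ring.
Qed.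

End InnerProduct.

Lemma normc_ge0 (R : realType) (z : R[i]) : 0 <= normc z.
Proof. by case: z => u v; exact: sqrtr_ge0. Qed.

Lemma normcX (R : realType) (z : R[i]) n : normc (z ^+ n) = normc z ^+ n.
Proof.
elim: n => [|n IH]; first by rewrite !expr0 normc1.
by rewrite !exprS normcM IH.
Qed.

Lemma normc_real (R : realType) (r : R) : 0 <= r -> normc r%:C = r.
Proof. by move=> r0; rewrite /normc /= expr0n addr0 sqrtr_sqr ger0_norm. Qed.

Lemma sqr_hnorm_pair (R : realType) (U V : prehilbertType R) (u : U * V) :
  hnorm u ^+ 2 = hnorm u.1 ^+ 2 + hnorm u.2 ^+ 2.
Proof. by rewrite !sqr_hnorm /rinner -raddfD. Qed.

(** * Convergence, closure and completeness expressed with real-valued norms *)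

Section HilbertConvergence.
Context {R : realType} {H : hilbertType R}.
Implicit Types (x y l : H) (u : nat -> H) (M : set H).

Lemma norm_hnorm x : `|x| = (hnorm x)%:C.
Proof.
apply/eqP; rewrite -(@eqrXn2 _ 2)//; last by rewrite ler0c hnorm_ge0.
by rewrite norm_inner innerxx -sqr_hnorm rmorphXn.
Qed.

Lemma hnorm_cvgP u l : u @ \oo --> l <->
  forall e : R, 0 < e -> exists N, forall n, (N <= n)%N -> hnorm (u n - l) < e.
Proof.
split=> [/cvgrPdist_lt ul e e0|ul].
  have /ul[N _ uN] : 0 < e%:C by rewrite ltcR.
  exists N => n Nn; rewrite -ltcR hdistC -norm_hnorm.
  exact: uN.
apply/cvgrPdist_lt => e e0.
have ee : (complex.Re e)%:C = e by rewrite RRe_real// gtr0_real.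
have /ul[N uN] : 0 < complex.Re e by rewrite -ltcR ee.
exists N => // n /= Nn; rewrite norm_hnorm hdistC -ee ltcR; exact: uN.
Qed.

Lemma hnorm_cauchy u :
  (forall e : R, 0 < e -> exists N, forall n, (N <= n)%N -> hnorm (u n - u N) < e) ->
  exists l, u @ \oo --> l.
Proof.
move=> uC; suff : cvgn u by move=> ?; exists (limn u).
apply/cauchy_cvgP/cauchyP => e e0.
have ee : (complex.Re e)%:C = e by rewrite RRe_real// gtr0_real.
have /uC[N uN] : 0 < complex.Re e by rewrite -ltcR ee.
exists (u N), N => // n /= Nn.
by rewrite -ball_normE /ball_ /= norm_hnorm hdistC -ee ltcR; exact: uN.
Qed.

Lemma closure_hnormP M x : closure M x <->
  forall e : R, 0 < e -> exists2 y, M y & hnorm (x - y) < e.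
Proof.
split=> [clx e e0|clx B].
  have e0' : 0 < e%:C by rewrite ltcR.
  have [y [My]] := clx _ (nbhsx_ballx x _ e0').
  by rewrite -ball_normE /ball_ /= norm_hnorm ltcR; exists y.
case/nbhs_ballP => e /= e0 eB.
have ee : (complex.Re e)%:C = e by rewrite RRe_real// gtr0_real.
have /clx[y My xy] : 0 < complex.Re e by rewrite -ltcR ee.
exists y; split=> //; apply: eB.
by rewrite -ball_normE /ball_ /= norm_hnorm -ee ltcR.
Qed.

Lemma closed_cvgn M u l : closed M -> (forall n, M (u n)) -> u @ \oo --> l -> M l.
Proof.
by move=> cM uM; apply: (closed_cvg M cM); apply: nearW => n; exact: uM.
Qed.

(** The increments are summed as a finite geometric series. The explicit distance to the limit is
    part of the conclusion because the gliding hump and the identity theorem for power series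
    compare a single term with the tail after it. *)
Lemma geometric_hnorm_cvg u (C q : R) : 0 <= q -> q < 1 ->
  (forall n, hnorm (u n.+1 - u n) <= C * q ^+ n) ->
  exists2 l, u @ \oo --> l &
    forall n, hnorm (l - u n) <= C * q ^+ n / (1 - q).
Proof.
move=> q0 q1 uq.
have C0 : 0 <= C.
  by have := uq 0%N; rewrite expr0 mulr1; apply: le_trans; exact: hnorm_ge0.
have q1' : 0 < 1 - q by rewrite subr_gt0.
have tele m n : hnorm (u (n + m)%N - u n) <= C * q ^+ n * (1 - q ^+ m) / (1 - q).
  elim: m => [|m IH]; first by rewrite addn0 subrr hnorm0 expr0 subrr mulr0 mul0r.
  apply: le_trans (hnorm_split (u (n + m)%N) _ _) _.
  rewrite addnS; apply: le_trans (lerD (uq _) IH) _.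
  rewrite le_eqVlt; apply/orP; left; apply/eqP.
  by rewrite exprD exprS; field; rewrite gt_eqF.
have unif n p : (n <= p)%N -> hnorm (u p - u n) <= C * q ^+ n / (1 - q).
  move=> /subnKC <-; apply: le_trans (tele _ _) _.
  rewrite ler_wpM2r ?invr_ge0 ?(ltW q1')// ler_piMr ?mulr_ge0 ?exprn_ge0//.
  by rewrite lerBlDr lerDl exprn_ge0.
have small e : 0 < e -> exists N, C * q ^+ N / (1 - q) < e.
  move=> e0.
  have : (fun n => C / (1 - q) * q ^+ n) @ \oo --> C / (1 - q) * 0.
    by apply: cvgMr; apply: cvg_expr; rewrite ger0_norm.
  rewrite mulr0 => /cvgrPdist_lt /(_ e e0)[N _ /(_ N (leqnn N))].
  rewrite sub0r normrN => h; exists N; apply: le_lt_trans h.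
  by rewrite mulrAC ler_norm.
have [l ul] : exists l, u @ \oo --> l.
  apply: hnorm_cauchy => e /small[N hN]; exists N => n Nn.
  exact: le_lt_trans (unif _ _ Nn) hN.
exists l => // n; apply/ler_addgt0Pr => e e0.
have /hnorm_cvgP/(_ e e0)[N hN] := ul.
apply: le_trans (hnorm_split (u (maxn N n)) _ _) _.
by rewrite [leRHS]addrC lerD ?unif ?leq_maxr// hdistC ltW// hN// leq_maxl.
Qed.

End HilbertConvergence.

(** * Bounded real functionals and their decay along a unilateral shift *)

(** Only real scalars occur, since the functionals of interest are real parts of inner products. *)
Definition bounded_rlinear {R : realType} {V : prehilbertType R} (phi : V -> R) :=
  (forall (a : R) x y, phi (a%:C *: x + y) = a * phi x + phi y) /\
  exists2 K, 0 <= K & forall x, `|phi x| <= K * hnorm x.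

(* A near-minimizer of [|g|^2 - 2 phi g] represents [phi] up to [e]; no
   completeness is needed. *)
Lemma approx_riesz (R : realType) (V : prehilbertType R) (phi : V -> R) :
  bounded_rlinear phi ->
  forall e, 0 < e -> exists g, forall h, `|phi h - rinner h g| <= e * hnorm h.
Proof.
move=> [phil [K K0 phiK]] e e0.
pose F g := rinner g g - 2 * phi g.
have Finf : has_inf (range F).
  split; first by exists (F 0), 0.
  exists (- K ^+ 2) => _ [g _ <-]; rewrite /F -sqr_hnorm.
  have := phiK g; rewrite ler_norml => /andP[_].
  by have := sqr_ge0 (hnorm g - K); rewrite sqrrB; lra.
have e2 : 0 < e ^+ 2 by rewrite exprn_gt0.
have [_ [g _ <-] gF] := inf_adherent e2 Finf.
exists g => h.
rewrite -(@ler_pXn2r _ 2) ?nnegrE ?mulr_ge0 ?hnorm_ge0 ?(ltW e0)//.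
rewrite -normrX ger0_norm ?sqr_ge0// exprMn sqr_hnorm.
rewrite -sqrrN opprB.
apply: quadratic_ge0_discr => [|t]; first exact: rinner_ge0.
(* Moving the near-minimizer [g] by [t h] lowers [F] by less than [e ^+ 2], so [e^2 + 2 (<h, g> -
   phi h) t + |h|^2 t^2 >= 0] for all [t]; the slack [e ^+ 2] becomes [e] after taking the
   discriminant. *)
have : inf (range F) <= F (t%:C *: h + g).
  by apply: ge_inf; [exact: Finf.2|exists (t%:C *: h + g)].
move: gF; rewrite /F phil !(rinnerDl, rinnerDr, rinnerZl, rinnerZr) (rinnerC g h).
lra.
Qed.

Section Shift.
Context {R : realType} {H : hilbertType R}.
Variable T : H -> H.
Hypothesis Tlin : forall (a : R[i]) (x y : H), T (a *: x + y) = a *: T x + T y.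

Lemma iter_linP n (a : R[i]) (x y : H) :
  iter n T (a *: x + y) = a *: iter n T x + iter n T y.
Proof. by elim: n => //= n ->. Qed.

Lemma iter_linD n (x y : H) : iter n T (x + y) = iter n T x + iter n T y.
Proof. by have := iter_linP n 1 x y; rewrite !scale1r. Qed.

Lemma iter_lin0 n : iter n T 0 = 0.
Proof. by have := iter_linD n 0 0; rewrite addr0 -[LHS]addr0 => /addrI. Qed.

Lemma iter_linZ n (a : R[i]) (x : H) : iter n T (a *: x) = a *: iter n T x.
Proof. by have := iter_linP n a x 0; rewrite iter_lin0 !addr0. Qed.

Lemma iter_linB n (x y : H) : iter n T (x - y) = iter n T x - iter n T y.
Proof. by rewrite -scaleN1r iter_linD iter_linZ scaleN1r. Qed.

Lemma iter_isometric n x : isometric_on setT T -> hnorm (iter n T x) = hnorm x.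
Proof. by move=> Ti; elim: n => //= n IH; rewrite Ti. Qed.

(** Approximate [h] by sums of vectors in the [T^p L]: [T^n] sends them into the [T^(n+p) L], and
    [n + p > k], so the result is orthogonal to [T^k L]. *)
Lemma unilateral_shift_rinner0 (L : set H) n k h x :
  isometric_on setT T -> closed_subspace L ->
  (forall m n x y, m <> n -> L x -> L y -> inner (iter m T x) (iter n T y) = 0) ->
  closure (linear_span (\bigcup_n (iter n T @` L))) = setT ->
  (k < n)%N -> L x -> rinner (iter n T h) (iter k T x) = 0.
Proof.
move=> Ti [_ L0 Lc] Lo Ld kn Lx; apply/eqP; rewrite -normr_le0.
apply/ler_addgt0Pr => e e0; rewrite add0r.
have /closure_hnormP : closure (linear_span (\bigcup_n (iter n T @` L))) h.
  by rewrite Ld.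
have e0' : 0 < e / (1 + hnorm x) by rewrite divr_gt0// ltr_wpDr ?hnorm_ge0.
move=> /(_ _ e0')[y ySp hy].
have y0 : rinner (iter n T y) (iter k T x) = 0.
  move: ySp => [m [c [v [Av ->]]]].
  have -> : iter n T (\sum_i c i *: v i) = \sum_i iter n T (c i *: v i).
    exact: (big_morph (iter n T) (@iter_linD n) (iter_lin0 n)).
  rewrite /rinner linear_sumlz raddf_sum big1// => i _ /=.
  have [p _ [l Ll <-]] := Av i.
  rewrite -iter_linZ -ssrnat.iterD Lo//.
    by move=> npk; move: kn; rewrite -npk ltnNge leq_addr.
  by rewrite -[_ *: _]addr0; exact: Lc.
have -> : rinner (iter n T h) (iter k T x) = rinner (iter n T (h - y)) (iter k T x).
  by rewrite iter_linB rinnerBl y0 subr0.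
apply: le_trans (rinner_le _ _) _; rewrite !iter_isometric//.
have x1 : 0 < 1 + hnorm x by rewrite ltr_wpDr ?hnorm_ge0.
rewrite ltr_pdivlMr// in hy.
apply: le_trans (ltW hy); rewrite ler_wpM2l ?hnorm_ge0//; lra.
Qed.

(** Replace [phi] by the inner product with some [g], then [g] by a finite sum of vectors from the
    [T^k L]. Once [n] exceeds every [k] that occurs, that sum is orthogonal to the range of [T^n],
    and only the two errors [e / 2] remain. *)
Lemma unilateral_shift_functional (phi : H -> R) : unilateral_shift T ->
  bounded_rlinear phi -> forall e, 0 < e ->
  exists N, forall n h, (N <= n)%N -> `|phi (iter n T h)| <= e * hnorm h.
Proof.
move=> [Ti [L [Lsub Lo Ld]]] phib e e0.
have e20 : 0 < e / 2 by rewrite divr_gt0.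
have [g gphi] := approx_riesz phib e20.
have /closure_hnormP : closure (linear_span (\bigcup_n (iter n T @` L))) g.
  by rewrite Ld.
move=> /(_ _ e20)[y [m [c [v [Av ->]]]] gy].
have /choice[k kP] : forall i, exists k, exists2 x, L x & iter k T x = v i.
  by move=> i; have [k _ [x Lx xv]] := Av i; exists k, x.
exists (\max_i k i).+1 => n h kn.
have y0 : rinner (iter n T h) (\sum_i c i *: v i) = 0.
  rewrite /rinner linear_sumr raddf_sum big1// => i _ /=.
  have [x Lx <-] := kP i; rewrite -iter_linZ.
  apply: (@unilateral_shift_rinner0 L) => //.
    by apply: leq_ltn_trans kn; exact: leq_bigmax.
  by rewrite -[_ *: _]addr0; have [_ L0 Lc] := Lsub; exact: Lc.
have := gphi (iter n T h); rewrite iter_isometric// => gh.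
have := ler_normD (phi (iter n T h) - rinner (iter n T h) g) (rinner (iter n T h) g).
rewrite subrK => phih.
have := rinner_le (iter n T h) (g - \sum_i c i *: v i).
rewrite rinnerBr y0 subr0 iter_isometric// => gyh.
have : hnorm h * hnorm (g - \sum_i c i *: v i) <= hnorm h * (e / 2).
  by rewrite ler_wpM2l ?hnorm_ge0// ltW.
lra.
Qed.
End Shift.

(* Gliding hump: if unit vectors [z n] in the range satisfy [|G (z n)| <= 8^-n],
   then [sum_n +-4^-n z n], with suitable signs, is a vector [G h] for which
   [<G h, z n> = <h, G (z n)>] is both at least [2/3 4^-n] in modulus and at most
   [|h| 8^-n]. *)
Lemma closed_range_bounded_below (R : realType) (H : hilbertType R) (G : H -> H) :
  (forall (a : R[i]) (x y : H), G (a *: x + y) = a *: G x + G y) ->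
  (forall x y, rinner (G x) y = rinner x (G y)) ->
  closed (range G) ->
  exists2 c : R, 0 < c & forall d, range G d -> c * hnorm d <= hnorm (G d).
Proof.
move=> Glin Gsym Gcl; apply: contrapT => Gnot.
have G0 : G 0 = 0 by have := iter_lin0 Glin 1.
have GZ (a : R[i]) (x : H) : G (a *: x) = a *: G x by have := iter_linZ Glin 1 a x.
(* The constant [8^-n] fails as a lower bound at some vector of the range; normalizing that vector
   gives [z n]. *)
have /choice[z zP] : forall n : nat, exists z : H,
    [/\ range G z, hnorm z = 1 & hnorm (G z) <= 8^-1 ^+ n].
  move=> n; apply: contrapT => zn; apply: Gnot.
  exists (8^-1 ^+ n); first by rewrite exprn_gt0.
  move=> _ [w _ <-]; rewrite leNgt; apply/negP => Gw.
  have [Gw0|Gw0] := eqVneq (G w) 0.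
    by move: Gw; rewrite Gw0 hnorm0 mulr0 ltNge hnorm_ge0.
  have w0 : 0 < hnorm (G w) by rewrite lt_def hnorm_eq0 Gw0 hnorm_ge0.
  apply: zn; exists ((hnorm (G w))^-1%:C *: G w); split.
  - by exists ((hnorm (G w))^-1%:C *: w).
  - by rewrite hnormZ normc_real ?invr_ge0 ?hnorm_ge0// mulVf// gt_eqF.
  - rewrite GZ hnormZ normc_real ?invr_ge0 ?hnorm_ge0//.
    by rewrite mulrC ler_pdivrMr// ltW.
(* The sign agrees with that of [<x, z n>], so the new term cannot cancel against the earlier
   ones. *)
pose s (x : H) (n : nat) : R := if 0 <= rinner x (z n) then 4^-1 ^+ n else - 4^-1 ^+ n.
pose x := fix x n := if n is m.+1 then (s (x m) m)%:C *: z m + x m else 0 : H.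
have xS n : x n.+1 = (s (x n) n)%:C *: z n + x n by [].
have q0 n : 0 < 4^-1 ^+ n :> R by rewrite exprn_gt0.
have xG n : range G (x n).
  elim: n => [|n [w _ wx]]; first by exists 0.
  have [[v _ vz] _ _] := zP n.
  by exists ((s (x n) n)%:C *: v + w); rewrite // xS Glin vz wx.
have zz n : rinner (z n) (z n) = 1.
  by have [_ zn _] := zP n; rewrite -sqr_hnorm zn expr1n.
have xz n : 4^-1 ^+ n <= `|rinner (x n.+1) (z n)|.
  rewrite xS rinnerDl rinnerZl zz mulr1 /s; case: ifP => [h|/negbT].
    by rewrite ger0_norm ?lerDl ?addr_ge0// ltW.
  by rewrite -ltNge => h; have := q0 n => q0n; rewrite ler0_norm; lra.
have xx n : hnorm (x n.+1 - x n) <= 1 * 4^-1 ^+ n.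
  have [_ zn _] := zP n.
  rewrite xS addrK hnormZ zn mulr1 mul1r /s; case: ifP => _.
    by rewrite normc_real// ltW.
  by rewrite /normc /= expr0n addr0 sqrrN sqrtr_sqr ger0_norm// ltW.
have [||l xl ll] := geometric_hnorm_cvg _ _ xx.
- by rewrite invr_ge0.
- lra.
have [h _ hl] : range G l by apply: closed_cvgn xl.
(* Of the [4^-n] present in [<x n.+1, z n>], the tail after [n.+1] removes at most
   [4^-(n+1) / (1 - 1/4) = 4^-n / 3]. *)
have lz n : 2 / 3 * 4^-1 ^+ n <= hnorm h * 8^-1 ^+ n.
  have [_ zn Gz] := zP n.
  have := rinner_le h (G (z n)); rewrite -Gsym hl => lz.
  have lx := ll n.+1; rewrite exprS in lx.
  have := rinner_le (l - x n.+1) (z n); rewrite zn mulr1 rinnerBl => lxz.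
  have := ler_normB (rinner l (z n)) (rinner l (z n) - rinner (x n.+1) (z n)).
  rewrite opprB addrC subrK => lnx.
  have hGz : hnorm h * hnorm (G (z n)) <= hnorm h * 8^-1 ^+ n by rewrite ler_wpM2l ?hnorm_ge0.
  have := xz n; move: lx; have -> : 1 - 4^-1 = 3 / 4 :> R by lra.
  rewrite invf_div; lra.
(* Dividing by [4^-n] leaves [2/3 * 2^n <= |h|]; the weaker bound by [n] already contradicts the
   Archimedean property. *)
have l2 n : 2 / 3 * n%:R <= hnorm h.
  have n2 : n%:R <= 2 ^+ n :> R by rewrite -natrX ler_nat ltnW// ltn_expl.
  have := lz n.
  have -> : 8^-1 ^+ n = 4^-1 ^+ n * 2^-1 ^+ n :> R by rewrite -exprMn; congr (_ ^+ _); lra.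
  rewrite [_ ^+ n * _]mulrC mulrA ler_pM2r//.
  rewrite exprVn ler_pdivlMr ?exprn_gt0//; lra.
have h0 : 0 <= 2 * hnorm h by rewrite mulr_ge0 ?hnorm_ge0.
by have := archi_boundP h0; have := l2 (Num.bound (2 * hnorm h)); lra.
Qed.

(** * Maps that are linear on a closed subspace *)

Section ClosedSubspace.
Context {R : realType} {H : hilbertType R} {D : set H}.
Hypothesis Dsub : closed_subspace D.

Lemma subspace0 : D 0. Proof. by case: Dsub. Qed.

Lemma subspaceP (a : R[i]) x y : D x -> D y -> D (a *: x + y).
Proof. by case: Dsub => _ _; exact. Qed.

Lemma subspaceD x y : D x -> D y -> D (x + y).
Proof. by move=> Dx Dy; rewrite -[x]scale1r; exact: subspaceP. Qed.

Lemma subspaceB x y : D x -> D y -> D (x - y).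
Proof. by move=> Dx Dy; rewrite -scaleN1r addrC; exact: subspaceP. Qed.

Section LinearOn.
Context {V : lmodType R[i]} {f : H -> V}.
Hypothesis flin : forall (a : R[i]) (x y : H), D x -> D y ->
  f (a *: x + y) = a *: f x + f y.

Lemma linear_onD x y : D x -> D y -> f (x + y) = f x + f y.
Proof. by move=> Dx Dy; have := flin 1 Dx Dy; rewrite !scale1r. Qed.

Lemma linear_on0 : f 0 = 0.
Proof.
have := linear_onD subspace0 subspace0.
by rewrite addr0 -[LHS]addr0 => /addrI.
Qed.

Lemma linear_onB x y : D x -> D y -> f (x - y) = f x - f y.
Proof.
by move=> Dx Dy; have := flin (-1) Dy Dx; rewrite !scaleN1r !(addrC (- _)).
Qed.

End LinearOn.

Lemma linear_on_cvg {K : hilbertType R} (f : H -> K) (u : nat -> H) l :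
  (forall (a : R[i]) (x y : H), D x -> D y -> f (a *: x + y) = a *: f x + f y) ->
  (forall x, D x -> hnorm (f x) <= hnorm x) ->
  (forall n, D (u n)) -> D l -> u @ \oo --> l -> (fun n => f (u n)) @ \oo --> f l.
Proof.
move=> flin fc uD lD /hnorm_cvgP ul; apply/hnorm_cvgP => e /ul[N uN].
exists N => n /uN; apply: le_lt_trans.
by rewrite -(linear_onB flin)//; exact/fc/subspaceB.
Qed.

End ClosedSubspace.

(** * Inverting [I - z B] on a subspace by the Neumann series *)

Section Resolvent.
Context {R : realType} {H : hilbertType R} {D : set H} {B : H -> H}.
Hypothesis Dsub : closed_subspace D.
Hypothesis BD : forall x, D x -> D (B x).
Hypothesis Blin : forall (a : R[i]) (x y : H), D x -> D y ->
  B (a *: x + y) = a *: B x + B y.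
Hypothesis Bc : forall x, D x -> hnorm (B x) <= hnorm x.

Lemma iter_on n x : D x -> D (iter n B x).
Proof. by move=> Dx; elim: n => //= n; exact: BD. Qed.

Lemma iter_on_le n x : D x -> hnorm (iter n B x) <= hnorm x.
Proof.
move=> Dx; elim: n => //= n; apply: le_trans.
exact/Bc/iter_on.
Qed.

Lemma iter_on_lin n (a : R[i]) (x y : H) : D x -> D y ->
  iter n B (a *: x + y) = a *: iter n B x + iter n B y.
Proof.
by move=> Dx Dy; elim: n => //= n ->; rewrite Blin//; exact: iter_on.
Qed.

Variable z : R[i].
Hypothesis z1 : normc z < 1.

(** The difference [w] satisfies [w = z B w], so [|w| <= |z| |w|] with [|z| < 1]. *)
Lemma resolvent_inj x y : D x -> D y -> x - z *: B x = y - z *: B y -> x = y.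
Proof.
move=> Dx Dy xy; have Dxy := subspaceB Dsub Dx Dy.
have e : x - y = z *: B (x - y).
  rewrite (linear_onB Blin)// scalerBr.
  move/eqP: xy; rewrite subr_eq => /eqP {1}->.
  by rewrite addrC !addrA addNr add0r addrC.
apply/eqP; rewrite -subr_eq0 -hnorm_eq0 eq_le hnorm_ge0 andbT.
have h : hnorm (x - y) <= normc z * hnorm (x - y).
  by rewrite {1}e hnormZ ler_wpM2l ?normc_ge0//; exact: Bc.
rewrite leNgt; apply/negP => h0.
by move: h; rewrite leNgt gtr_pMl// z1.
Qed.

Lemma resolvent_series d : D d -> exists x,
  [/\ D x, x - z *: B x = d &
    series (fun n => z ^+ n *: iter n B d) @ \oo --> x].
Proof.
move=> Dd; set u := series _.
have uS n : u n.+1 = z ^+ n *: iter n B d + u n by rewrite /u seriesSr addrC.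
have uD n : D (u n).
  elim: n => [|n IH]; first by rewrite /u /series /= big_geq//; exact: subspace0.
  by rewrite uS; apply: subspaceP => //; exact: iter_on.
(* This recursion passes to the limit and becomes the resolvent equation. *)
have uR n : u n.+1 = d + z *: B (u n).
  elim: n => [|n IH].
    rewrite uS expr0 scale1r /= /u /series /= !big_geq// (linear_on0 Dsub Blin).
    by rewrite scaler0.
  rewrite (uS n.+1) {1}IH (uS n) Blin//; last exact: iter_on.
  by rewrite exprS scalerDr scalerA addrCA.
have [|l ul _] := geometric_hnorm_cvg (u := u) (C := hnorm d) (normc_ge0 z) z1.
  move=> n; rewrite uS addrK hnormZ normcX mulrC ler_wpM2r ?exprn_ge0 ?normc_ge0//.
  exact: iter_on_le.
have Dl : D l by apply: closed_cvgn ul => //; case: Dsub.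
exists l; split=> //.
have Bu := linear_on_cvg Dsub Blin Bc uD Dl ul.
apply/eqP; rewrite -subr_eq0 -hnorm_eq0 -normr_le0 ger0_norm ?hnorm_ge0//.
apply/ler_addgt0Pr => e e0; rewrite add0r.
have e2 : 0 < e / 2 by rewrite divr_gt0.
have /hnorm_cvgP/(_ _ e2)[N1 h1] := ul.
have /hnorm_cvgP/(_ _ e2)[N2 h2] := Bu.
pose n := maxn N1 N2.
have := h1 n.+1 (leqW (leq_maxl _ _)); have := h2 n (leq_maxr _ _).
rewrite uR => hB hu.
have -> : l - z *: B l - d = (l - (d + z *: B (u n))) + z *: (B (u n) - B l).
  by rewrite scalerBr opprD addrA addrA addrNK addrAC.
have := hnorm_triangle (l - (d + z *: B (u n))) (z *: (B (u n) - B l)).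
rewrite hnormZ (hdistC l) => tri.
have : normc z * hnorm (B (u n) - B l) <= 1 * hnorm (B (u n) - B l).
  by rewrite ler_wpM2r ?hnorm_ge0// ltW.
lra.
Qed.

End Resolvent.

(** * Uniqueness of Taylor coefficients and the Hardy norm *)

Section TaylorCoefficients.
Context {R : realType} {E : hilbertType R}.
Implicit Types (f : disc R -> E) (a : nat -> E).

(** By strong induction: once the earlier coefficients vanish, the sum at a small [t > 0] is
    [t^n c n] plus a tail of order [t^(n+1)], and letting [t] tend to 0 forces [c n = 0]. *)
Lemma power_series_eq0 (c : nat -> E) :
  (forall z : R[i], normc z < 1 -> series (fun n => z ^+ n *: c n) @ \oo --> (0 : E)) ->
  forall n, c n = 0.
Proof.
move=> c0.
(* At [z = 1/2] two consecutive partial sums eventually have norm below 1, so the term between them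
   has norm at most 2; [M] also absorbs the first [N] coefficients. *)
have [M M0 cM] : exists2 M : R, 0 <= M & forall n, hnorm (c n) <= M * 2 ^+ n.
  have h1 : normc (2^-1%:C : R[i]) < 1 by rewrite normc_real; lra.
  have /hnorm_cvgP/(_ 1 ltr01)[N hN] := c0 _ h1.
  pose M := \sum_(i < N) hnorm (c i) + 2.
  have M0 : 0 <= M by rewrite addr_ge0// sumr_ge0// => i _; exact: hnorm_ge0.
  exists M => // n; have [nN|Nn] := ltnP n N.
    apply: (@le_trans _ _ M); last by rewrite ler_peMr// exprn_ege1// ler1n.
    rewrite /M (bigD1 (Ordinal nN))//= -addrA lerDl addr_ge0//.
    by rewrite sumr_ge0// => i _; exact: hnorm_ge0.
  have := hN _ Nn; have := hN _ (leqW Nn); rewrite !subr0 seriesSr => hn1 hn.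
  set s := series _ n in hn1 hn; set t := _ *: c n in hn1.
  have tt : hnorm t = 2^-1 ^+ n * hnorm (c n).
    by rewrite /t hnormZ normcX normc_real// invr_ge0.
  have : hnorm t <= hnorm (s + t) + hnorm s.
    by have := hnorm_triangleB (s + t) s; rewrite addrAC subrr add0r.
  rewrite tt exprVn ler_pdivrMl ?exprn_gt0// mulrC => h; apply: le_trans h _.
  rewrite ler_wpM2r ?exprn_ge0//.
  have : 0 <= \sum_(i < N) hnorm (c i) by rewrite sumr_ge0// => i _; exact: hnorm_ge0.
  by rewrite /M; lra.
move=> n; elim/ltn_ind: n => n IH.
apply/eqP; rewrite -hnorm_eq0 eq_le hnorm_ge0 andbT.
have key t : 0 < t -> t < 4^-1 -> hnorm (c n) <= M * 2 ^+ n * 4 * t.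
  move=> t0 t4.
  have t1 : normc (t%:C : R[i]) < 1 by rewrite normc_real ?ltW//; lra.
  (* The shift by [n.+1] makes [u 0] consist of the single term [t^n c n]. *)
  pose u m := series (fun n => t%:C ^+ n *: c n) (m + n.+1)%N.
  have uS m : u m.+1 = u m + t%:C ^+ (m + n.+1) *: c (m + n.+1)%N.
    by rewrite /u addSn seriesSr.
  have u0 : u 0%N = t%:C ^+ n *: c n.
    rewrite /u add0n seriesSr /series /= big_nat big1 ?add0r// => i /= /IH ->.
    by rewrite scaler0.
  have [|||l ul ll] := @geometric_hnorm_cvg _ _ u (M * (2 * t) ^+ n.+1) (2 * t).
  - by rewrite mulr_ge0// ltW.
  - by lra.
  - move=> m; rewrite uS addrAC subrr add0r hnormZ normcX normc_real ?(ltW t0)//.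
    rewrite -mulrA -exprD [(n.+1 + m)%N]addnC exprMn mulrA mulrC.
    by rewrite ler_wpM2r ?exprn_ge0 ?cM// ltW.
  have l0 : l = 0.
    apply: cvg_unique ul _; first exact: norm_hausdorff.
    have := c0 _ t1; rewrite -(cvg_shiftn n.+1); exact.
  have := ll 0%N; rewrite l0 sub0r hnorm_opp u0 expr0 mulr1 hnormZ normcX.
  rewrite normc_real ?(ltW t0)// => h.
  have tn : 0 < t ^+ n by rewrite exprn_gt0.
  have t2 : 2^-1 <= 1 - 2 * t by lra.
  have K0 : 0 <= M * (2 * t) ^+ n.+1 by rewrite !mulr_ge0 ?exprn_ge0// mulr_ge0// ltW.
  have {}h : t ^+ n * hnorm (c n) <= M * (2 * t) ^+ n.+1 * 2.
    apply: le_trans h _; rewrite ler_wpM2l// invf_ple ?posrE//; lra.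
  rewrite -(ler_pM2l tn); apply: le_trans h _.
  rewrite exprMn !exprS le_eqVlt; apply/orP; left; apply/eqP; ring.
apply/ler_addgt0Pr => e e0; rewrite add0r.
pose K := M * 2 ^+ n * 4.
have K0 : 0 <= K by rewrite !mulr_ge0 ?exprn_ge0.
(* The bound [1/5] ensures [t < 1/4], and [K + 1] is positive even when [K = 0]. *)
pose t := Num.min 5^-1 (e / (K + 1)).
have K1 : 0 < K + 1 by lra.
have t0 : 0 < t by rewrite lt_min invr_gt0 ltr0n divr_gt0.
have t5 : t <= 5^-1 by rewrite ge_min lexx.
have te : t <= e / (K + 1) by rewrite ge_min lexx orbT.
have : hnorm (c n) <= K * t by apply: key => //; lra.
by rewrite ler_pdivlMr// in te; lra.
Qed.

Lemma taylor_coefs_inj f a b : taylor_coefs f a -> taylor_coefs f b -> a = b.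
Proof.
move=> fa fb; apply/funext => n; apply/eqP; rewrite -subr_eq0; apply/eqP.
move: n; apply: power_series_eq0 => z z1.
have zd : `|z| < 1 by rewrite (_ : `|z| = (normc z)%:C)// ltcR.
rewrite (_ : series _ =
  series (fun n => z ^+ n *: a n) - series (fun n => z ^+ n *: b n)); last first.
  apply/funext => n; rewrite /series /= [RHS]/GRing.add /=.
  by rewrite -sumrB; apply: eq_bigr => i _; rewrite scalerBr.
rewrite -[0 : E](subrr (f (exist _ z zd))).
exact: cvgB (fa (exist _ z zd)) (fb (exist _ z zd)).
Qed.

(** [hardy2_norm] picks a coefficient sequence by choice; uniqueness identifies it with the given
    one. *)
Lemma hardy2_normE f a : taylor_coefs f a ->
  hardy2_norm f = Num.sqrt (limn (series (fun n => hnorm (a n) ^+ 2))).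
Proof.
move=> fa; rewrite /hardy2_norm; case: xgetP => [b _ fb|/(_ a)]; last by [].
by rewrite (taylor_coefs_inj fa fb).
Qed.

End TaylorCoefficients.

(** * Strong convergence of the iterates of [B] to 0 *)

Section StrongStability.
Context {R : realType} {H : hilbertType R} {D : set H} {B G T : H -> H}.
Hypothesis Dsub : closed_subspace D.
Hypothesis BD : forall x, D x -> D (B x).
Hypothesis Blin : forall (a : R[i]) (x y : H), D x -> D y ->
  B (a *: x + y) = a *: B x + B y.
Hypothesis Bc : forall x, D x -> hnorm (B x) <= hnorm x.

Lemma iter_on_antimono m n x : D x -> (m <= n)%N ->
  hnorm (iter n B x) <= hnorm (iter m B x).
Proof.
move=> Dx /subnK <-; rewrite ssrnat.iterD.
by apply: (iter_on_le BD Bc); exact: (iter_on BD).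
Qed.

Lemma sqr_hnormP (V : prehilbertType R) (t : R) (x y : V) :
  hnorm (t%:C *: x + y) ^+ 2 =
  hnorm y ^+ 2 + 2 * rinner y x * t + hnorm x ^+ 2 * t ^+ 2.
Proof.
rewrite !sqr_hnorm !(rinnerDl, rinnerDr, rinnerZl, rinnerZr) (rinnerC x y).
ring.
Qed.

(* Cauchy-Schwarz for the positive form [B^*m B^m - B^*n B^n]. *)
Lemma rinner_iter_diff m n x y : D x -> D y -> (m <= n)%N ->
  (rinner (iter m B x) (iter m B y) - rinner (iter n B x) (iter n B y)) ^+ 2 <=
  (hnorm (iter m B x) ^+ 2 - hnorm (iter n B x) ^+ 2) * hnorm y ^+ 2.
Proof.
move=> Dx Dy mn.
have dec z : D z -> 0 <= hnorm (iter m B z) ^+ 2 - hnorm (iter n B z) ^+ 2.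
  by move=> Dz; rewrite subr_ge0 ler_pXn2r ?nnegrE ?hnorm_ge0// iter_on_antimono.
apply: (@le_trans _ _ ((hnorm (iter m B x) ^+ 2 - hnorm (iter n B x) ^+ 2) *
  (hnorm (iter m B y) ^+ 2 - hnorm (iter n B y) ^+ 2))); last first.
  rewrite ler_wpM2l ?dec// lerBlDr ler_wpDr ?sqr_ge0//.
  by rewrite ler_pXn2r ?nnegrE ?hnorm_ge0// (iter_on_le BD Bc).
apply: quadratic_ge0_discr => [|t]; first exact: dec.
have := dec _ (subspaceP Dsub t%:C Dy Dx).
rewrite !(iter_on_lin BD Blin) ?sqr_hnormP//.
by congr (_ <= _); ring.
Qed.

(** Take [m] to attain the infimum of the squared norms up to [e]. *)
Lemma hnorm_iter_almost_stationary x e : D x -> 0 < e ->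
  exists m, forall n, hnorm (iter m B x) ^+ 2 - hnorm (iter n B x) ^+ 2 <= e.
Proof.
move=> Dx e0; pose s n := hnorm (iter n B x) ^+ 2.
have sinf : has_inf (range s).
  by split; [exists (s 0%N), 0%N|exists 0 => _ [n _ <-]; exact: sqr_ge0].
have [_ [m _ <-] sm] := inf_adherent e0 sinf.
exists m => n; have : inf (range s) <= s n by apply: ge_inf; [exact: sinf.2|exists n].
by move: sm; rewrite /s; lra.
Qed.

Hypothesis GD : forall x, D (G x).
Hypothesis Glin : forall (a : R[i]) (x y : H), G (a *: x + y) = a *: G x + G y.
Hypothesis Gsym : forall x y, rinner (G x) y = rinner x (G y).
Variables K c : R.
Hypothesis K0 : 0 <= K.
Hypothesis GK : forall x, hnorm (G x) <= K * hnorm x.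
Hypothesis c0 : 0 < c.
Hypothesis Gc : forall x, D x -> c * hnorm x <= hnorm (G x).
Hypothesis Tlin : forall (a : R[i]) (x y : H), T (a *: x + y) = a *: T x + T y.
Hypothesis Tshift : unilateral_shift T.
Hypothesis BGT : forall x, B (G (T x)) = G x.

Lemma iter_BGT n x : iter n B (G (iter n T x)) = G x.
Proof. by elim: n => // n IH; rewrite iterSr iterS BGT. Qed.

(** Here [G] stands for [D_X]. The index [m] is fixed first, to make the forms almost stationary at
    [x]; it determines the functional [phi], and the shift then supplies [N]. *)
Lemma strongly_stable x : D x ->
  forall e, 0 < e -> exists N, forall n, (N <= n)%N -> hnorm (iter n B x) < e.
Proof.
move=> Dx e e0.
have K1 : 0 < K + 1 by rewrite ltr_wpDl.
(* With these choices [e1 + e1 * K = e2], so the final bound [e2 + e1 * K] is below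
   [2 * e2 = c * e / 2]. *)
pose e1 := c * e / (4 * (K + 1)); pose e2 := c * e / 4.
have e10 : 0 < e1 by rewrite !(divr_gt0, mulr_gt0).
have e20 : 0 < e2 by rewrite !(divr_gt0, mulr_gt0).
have e1K : e1 * (K + 1) = e2 by rewrite /e1 /e2; field; rewrite gt_eqF.
have e2E : 4 * e2 = c * e by rewrite /e2; field.
clearbody e1 e2.
have [m xm] := hnorm_iter_almost_stationary Dx (exprn_gt0 2 e10).
pose phi y := rinner (iter m B (G y)) (iter m B x).
have phib : bounded_rlinear phi.
  split=> [a y z|]; first by rewrite /phi Glin (iter_on_lin BD Blin)// rinnerDl rinnerZl.
  exists (K * hnorm x); first by rewrite mulr_ge0 ?hnorm_ge0.
  move=> y; apply: le_trans (rinner_le _ _) _; rewrite mulrAC ler_pM ?hnorm_ge0//.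
    exact: le_trans (iter_on_le BD Bc _ (GD y)) (GK y).
  exact: (iter_on_le BD Bc).
have [N phiN] := unilateral_shift_functional Tlin Tshift phib e20.
exists (maxn m N) => n; rewrite geq_max => /andP[mn Nn].
pose h := G (iter n B x).
have Dn k : D (iter k B x) by exact: (iter_on BD).
(* Symmetry moves one [G] across, and the resulting [G h] is rewritten as [B^n G T^n h], so both
   arguments carry [B^n]. *)
have hh : hnorm h ^+ 2 = rinner (iter n B x) (iter n B (G (iter n T h))).
  by rewrite iter_BGT sqr_hnorm /h Gsym.
have hT : hnorm (G (iter n T h)) <= K * hnorm h.
  by apply: le_trans (GK _) _; rewrite iter_isometric//; case: Tshift.
have diff : `|rinner (iter m B x) (iter m B (G (iter n T h))) - hnorm h ^+ 2|
    <= e1 * (K * hnorm h).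
  rewrite -(@ler_pXn2r _ 2) ?nnegrE ?mulr_ge0 ?hnorm_ge0// ?(ltW e10)//.
  rewrite -normrX ger0_norm ?sqr_ge0// hh.
  apply: le_trans (rinner_iter_diff Dx (GD _) mn) _.
  rewrite exprMn ler_pM ?sqr_ge0 ?subr_ge0 ?ler_pXn2r ?nnegrE ?mulr_ge0//;
    by rewrite ?hnorm_ge0// iter_on_antimono.
have := phiN n h Nn; rewrite /phi rinnerC => small.
have : hnorm h ^+ 2 <= (e2 + e1 * K) * hnorm h.
  by move: diff small; rewrite !ler_norml => /andP[d1 _] /andP[_ s2]; lra.
rewrite expr2 => h2.
(* The estimate is quadratic on the left and linear on the right; dividing by [|h|] requires
   treating [h = 0] apart. *)
have hle : hnorm h <= e2 + e1 * K.
  have [h0|hn0] := eqVneq (hnorm h) 0.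
    by rewrite h0 addr_ge0 ?mulr_ge0// ltW.
  by rewrite -(@ler_pM2r _ (hnorm h))// lt_def hn0 hnorm_ge0.
rewrite -(ltr_pM2l c0); apply: le_lt_trans (Gc (Dn n)) _.
apply: le_lt_trans hle _; rewrite mulrDr mulr1 in e1K.
have := mulr_gt0 c0 e0; lra.
Qed.

End StrongStability.

(** * Defect operators and orthogonality *)

Section Defect.
Context {R : realType} {H K : hilbertType R} {C : H -> K} {D : H -> H}.
Hypothesis CD : defect_operator C D.

Lemma defect_linear (a : R[i]) (x y : H) : D (a *: x + y) = a *: D x + D y.
Proof. by case: CD => -[_ Dl _] _ _; exact: Dl. Qed.

(** Positivity makes [<D v, v>] real; the vanishing imaginary part at [v = i x + y] is the asserted
    symmetry. *)
Lemma defect_sym x y : rinner (D x) y = rinner x (D y).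
Proof.
have [_ Dge0 _] := CD.
have := ger0_Im (Dge0 ('i *: x + y)).
rewrite defect_linear linearDl !linearDr /=.
rewrite ![inner ('i *: _) _]innerZl ![inner _ ('i *: _)]innerZr.
have Ix := ger0_Im (Dge0 x); have Iy := ger0_Im (Dge0 y).
rewrite [rinner x _]rinnerC /rinner.
move: Ix Iy; case: (inner (D x) x) => ? ?; case: (inner (D y) y) => ? ?.
case: (inner (D x) y) => ? ?; case: (inner (D y) x) => ? ? /=.
lra.
Qed.

Lemma sqr_hnorm_defect x : hnorm (D x) ^+ 2 = hnorm x ^+ 2 - hnorm (C x) ^+ 2.
Proof.
have [_ _ [Cs [_ Cadj] DD]] := CD.
rewrite !sqr_hnorm defect_sym DD rinnerBr; congr (_ - _).
by rewrite /rinner -Cadj.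
Qed.

Lemma hnorm_defect_le x : hnorm (D x) <= hnorm x.
Proof.
apply: hnorm_le_sqr; first exact: hnorm_ge0.
by rewrite sqr_hnorm_defect lerBlDr lerDl sqr_ge0.
Qed.

Lemma range_closure_defect : closed_subspace (range_closure D).
Proof.
split; first exact: closed_closure.
- by apply: subset_closure; exists 0 => //; exact: (iter_lin0 defect_linear 1).
- move=> a x y /closure_hnormP xD /closure_hnormP yD; apply/closure_hnormP => e e0.
  have a1 : 0 < normc a + 1 by rewrite ltr_wpDl ?normc_ge0.
  have ea : 0 < e / 2 / (normc a + 1) by rewrite !divr_gt0.
  have e2 : 0 < e / 2 by rewrite divr_gt0.
  have [_ [u _ <-] xu] := xD _ ea; have [_ [v _ <-] yv] := yD _ e2.
  exists (a *: D u + D v); first by exists (a *: u + v) => //; exact: defect_linear.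
  have -> : a *: x + y - (a *: D u + D v) = a *: (x - D u) + (y - D v).
    by rewrite opprD addrACA scalerBr.
  apply: le_lt_trans (hnorm_triangle _ _) _; rewrite hnormZ.
  rewrite ltr_pdivlMr// in xu.
  have := hnorm_ge0 (x - D u); lra.
Qed.

End Defect.

(** The real part of [<x, i m>] is the imaginary part of [<x, m>]. *)
Lemma orth_rinner (R : realType) (V : prehilbertType R) (M : set V) x :
  (forall m, M m -> M ('i *: m)) -> (forall m, M m -> rinner x m = 0) -> orth M x.
Proof.
move=> Mi xM m Mm; have := xM _ Mm; have := xM _ (Mi _ Mm).
rewrite /rinner innerZr; case: (inner x m) => u v /=.
rewrite !(mul0r, add0r, sub0r, mulN1r, mul1r, opprK) => v0 u0.
by apply/eqP; rewrite eq_complex /= u0 eqxx /=; apply/eqP; move: v0; lra.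
Qed.

(** * Transfer function of an isometric colligation *)

Section Colligation.
Context {R : realType} {H K : hilbertType R} {D : set H} {E : set K} {W : H -> K * H}.
Hypothesis Dsub : closed_subspace D.
Hypothesis WD : forall x, D x -> (E `*` D) (W x).
Hypothesis Wlin : forall (a : R[i]) (x y : H), D x -> D y ->
  W (a *: x + y) = a *: W x + W y.
Hypothesis Wiso : isometric_on D W.

Let A x := (W x).1.
Let B x := (W x).2.

Let BD x : D x -> D (B x). Proof. by move=> /WD[]. Qed.

Let Alin (a : R[i]) (x y : H) : D x -> D y -> A (a *: x + y) = a *: A x + A y.
Proof. by move=> Dx Dy; rewrite /A Wlin. Qed.

Let Blin (a : R[i]) (x y : H) : D x -> D y -> B (a *: x + y) = a *: B x + B y.
Proof. by move=> Dx Dy; rewrite /B Wlin. Qed.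

Let ABiso x : D x -> hnorm x ^+ 2 = hnorm (A x) ^+ 2 + hnorm (B x) ^+ 2.
Proof. by move=> /Wiso <-; exact: sqr_hnorm_pair. Qed.

Let Ac x : D x -> hnorm (A x) <= hnorm x.
Proof.
by move=> Dx; apply: hnorm_le_sqr; rewrite ?hnorm_ge0// (ABiso Dx) lerDl sqr_ge0.
Qed.

Let Bc x : D x -> hnorm (B x) <= hnorm x.
Proof.
by move=> Dx; apply: hnorm_le_sqr; rewrite ?hnorm_ge0// (ABiso Dx) lerDr sqr_ge0.
Qed.

(** The inverse of [I - z B] on [D], written with ['pinv_] in the same form as in [schur_Gamma]. *)
Definition colligation_resolvent (z : disc R) : H -> H :=
  'pinv_(fun=> 0) D (fun g => g - val z *: (W g).2).

(** This is [A (I - z B)^-1], where [W = (A, B)]. *)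
Definition transfer_function (z : disc R) (d : H) : K :=
  (W (colligation_resolvent z d)).1.

Lemma normc_disc (z : disc R) : normc (val z) < 1.
Proof. by rewrite -ltcR; exact: valP z. Qed.

(** Injectivity and the Neumann series show that [I - z B] is a bijection of [D], so the partial
    inverse is a true inverse there. *)
Lemma colligation_resolventP (z : disc R) d : D d ->
  let x := colligation_resolvent z d in D x /\ x - val z *: B x = d.
Proof.
move=> Dd /=; set f := fun g => g - val z *: (W g).2.
have finj : {in D &, injective f}.
  move=> x y /set_mem Dx /set_mem Dy.
  exact: (resolvent_inj Dsub Blin Bc (normc_disc z)).
have [x [Dx xd _]] := resolvent_series Dsub BD Blin Bc (normc_disc z) Dd.
have fd : (f @` D) d by exists x.
split; last by apply: (@pinvK _ _ (fun=> 0) D f d); exact: mem_set.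
by rewrite -{1}(injpinv_image (fun=> 0) finj); exists d.
Qed.

Lemma colligation_resolvent_eq (z : disc R) x d : D x -> D d ->
  x - val z *: B x = d -> colligation_resolvent z d = x.
Proof.
move=> Dx Dd xd; have [Dy yd] := colligation_resolventP z Dd.
by apply: (resolvent_inj Dsub Blin Bc (normc_disc z)); rewrite ?yd.
Qed.

(** Apply [A] to the Neumann series term by term. *)
Lemma transfer_function_taylor d : D d ->
  taylor_coefs (fun z => transfer_function z d) (fun n => A (iter n B d)).
Proof.
move=> Dd z.
have [x [Dx xd xs]] := resolvent_series Dsub BD Blin Bc (normc_disc z) Dd.
rewrite /transfer_function (colligation_resolvent_eq Dx Dd xd).
have uD n : D (series (fun n => val z ^+ n *: iter n B d) n).
  elim: n => [|n IH].
    by rewrite /series /= big_geq//; exact: subspace0.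
  rewrite seriesSr addrC; apply: subspaceP => //; exact: (iter_on BD).
have := linear_on_cvg Dsub Alin Ac uD Dx xs.
rewrite (_ : (fun n => A _) = series (fun n => val z ^+ n *: A (iter n B d)))//.
apply/funext; elim=> [|n IH].
  by rewrite /series /= !big_geq//; exact: (linear_on0 Dsub Alin).
by rewrite !seriesSr addrC Alin// ?IH 1?addrC//; exact: (iter_on BD).
Qed.

Lemma transfer_function_linear z (a : R[i]) (x y : H) : D x -> D y ->
  transfer_function z (a *: x + y) = a *: transfer_function z x + transfer_function z y.
Proof.
move=> Dx Dy.
have [Du ux] := colligation_resolventP z Dx.
have [Dv vy] := colligation_resolventP z Dy.
rewrite /transfer_function (@colligation_resolvent_eq z
  (a *: colligation_resolvent z x + colligation_resolvent z y)); first exact: Alin.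
- exact: subspaceP.
- exact: subspaceP.
rewrite Blin// -[in RHS]ux -[in RHS]vy scalerDr opprD addrACA scalerBr.
by rewrite !scalerA mulrC.
Qed.

(** From [(I - z B)^-1 x = x + z (I - z B)^-1 B x]. With [x = D_X T h] and [y = D_X h] it becomes
    the intertwining relation in the Hardy component. *)
Lemma transfer_function_shift z x y : D x -> D y -> B x = y ->
  transfer_function z x = A x + val z *: transfer_function z y.
Proof.
move=> Dx Dy xy; have [Dv vy] := colligation_resolventP z Dy.
rewrite /transfer_function (@colligation_resolvent_eq z
  (val z *: colligation_resolvent z y + x))//.
- by rewrite [RHS]addrC; exact: Alin.
- exact: subspaceP.
have e : val z *: B (colligation_resolvent z y) + y = colligation_resolvent z y.
  by rewrite -[X in _ + X]vy addrC subrK.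
rewrite Blin// xy e.
by rewrite addrAC subrr add0r.
Qed.

(** Telescoping of [|B^k d|^2 = |A B^k d|^2 + |B^(k+1) d|^2]. *)
Lemma transfer_function_partial_sum d n : D d ->
  series (fun n => hnorm (A (iter n B d)) ^+ 2) n =
  hnorm d ^+ 2 - hnorm (iter n B d) ^+ 2.
Proof.
move=> Dd; elim: n => [|n IH]; first by rewrite /series /= big_geq// subrr.
have := ABiso (iter_on BD n Dd).
by rewrite seriesSr IH iterS => ->; ring.
Qed.

Lemma transfer_function_sum d : D d ->
  (forall e, 0 < e -> exists N, forall n, (N <= n)%N -> hnorm (iter n B d) < e) ->
  series (fun n => hnorm (A (iter n B d)) ^+ 2) @ \oo --> hnorm d ^+ 2.
Proof.
move=> Dd stab.
have B0 : (fun n => hnorm (iter n B d)) @ \oo --> (0 : R).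
  apply/cvgrPdist_lt => e /stab[N hN]; exists N => // n /= /hN.
  by rewrite sub0r normrN ger0_norm ?hnorm_ge0.
rewrite (_ : series _ = (fun n => hnorm d ^+ 2 - hnorm (iter n B d) * hnorm (iter n B d))).
  rewrite -[X in _ --> X]subr0 -[X in _ - X](mulr0 0).
  by apply: cvgB; [exact: cvg_cst|exact: cvgM].
by apply/funext => n; rewrite transfer_function_partial_sum// -expr2.
Qed.

End Colligation.

(** * The isometric colligation built from [wb] and a constant isometry *)

Lemma rinner_polar (R : realType) (V : prehilbertType R) (x y : V) :
  2 * rinner x y = hnorm (x + y) ^+ 2 - hnorm x ^+ 2 - hnorm y ^+ 2.
Proof. by rewrite !sqr_hnorm !(rinnerDl, rinnerDr) (rinnerC y x); ring. Qed.

Lemma hnorm_pythagoras (R : realType) (V : prehilbertType R) (x y : V) :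
  rinner x y = 0 -> hnorm (x + y) ^+ 2 = hnorm x ^+ 2 + hnorm y ^+ 2.
Proof. by have := rinner_polar x y; lra. Qed.

Section FreeSchurContraction.
Context {R : realType} {H H' : hilbertType R}.
Context {T : H -> H} {T' : H' -> H'} {X : H -> H'} {DT' : H' -> H'} {DX : H -> H}.
Context {om wb : H -> H' * H} {wbs : H' * H -> H} {R0 : H -> H' * H}.
Let D := range_closure DX.
Let E := range_closure DT'.
Let M := range_closure (DX \o T).
Let ker_wb := ker_on D wb.
Let ker_wbs := ker_on (E `*` D) wbs.
Hypothesis Tlin : forall (a : R[i]) (x y : H), T (a *: x + y) = a *: T x + T y.
Hypothesis Tiso : isometric_on setT T.
Hypothesis TX : forall h, T' (X h) = X (T h).
Hypothesis DT'P : defect_operator T' DT'.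
Hypothesis DXP : defect_operator X DX.
Hypothesis omP : is_omega T X DT' DX om.
Hypothesis wbP : is_omega_bar T DT' DX om wb.
Hypothesis wbsP : adjoint_on D (E `*` D) wb wbs.
Hypothesis DXTcl : closed (range (DX \o T)).
Hypothesis R0P : bounded_operator ker_wb ker_wbs R0.
Hypothesis R0iso : isometric_on ker_wb R0.

Let Dsub : closed_subspace D. Proof. exact: range_closure_defect DXP. Qed.
Let Esub : closed_subspace E. Proof. exact: range_closure_defect DT'P. Qed.

Let MD m : M m -> D m.
Proof. by apply: closure_subset => _ [h _ <-]; exists (T h). Qed.

Let DXD h : D (DX h). Proof. by apply: subset_closure; exists h. Qed.

(** Since the range is closed, each element of [M] is some [D_X T h], where [wb] is given by a
    formula. *)
Let ME : M = range (DX \o T).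
Proof. by rewrite /M /range_closure -(closure_id _).1. Qed.

Let wbD x : D x -> (E `*` D) (wb x). Proof. by case: wbP => -[+ _ _ _ _]; exact. Qed.

Let wb_lin (a : R[i]) (x y : H) : D x -> D y -> wb (a *: x + y) = a *: wb x + wb y.
Proof. by case: wbP => -[_ + _ _ _]; exact. Qed.

Let wbsD x : (E `*` D) x -> D (wbs x). Proof. by case: wbsP => -[+ _ _ _]; exact. Qed.

Let wbs_lin (a : R[i]) (x y : H' * H) : (E `*` D) x -> (E `*` D) y ->
  wbs (a *: x + y) = a *: wbs x + wbs y.
Proof. by case: wbsP => -[_ + _ _]; exact. Qed.

Let wb_adj x y : D x -> (E `*` D) y -> rinner (wb x) y = rinner x (wbs y).
Proof. by case: wbsP => _ adj Dx Ey; rewrite /rinner adj. Qed.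

Let wb_DXT h : wb (DX (T h)) = (DT' (X h), DX h).
Proof.
have [_ wbM _] := wbP; rewrite wbM; first by case: omP => _ ->.
by apply: subset_closure; exists h.
Qed.

(** Both sides squared equal [|h|^2 - |X T h|^2], by [T' X = X T] and the isometry of [T]. *)
Let wb_M_iso m : M m -> hnorm (wb m) = hnorm m.
Proof.
rewrite ME => -[h _ <-]; rewrite /= wb_DXT.
apply/eqP; rewrite -(@eqrXn2 _ 2) ?hnorm_ge0//; apply/eqP.
rewrite sqr_hnorm_pair /= (sqr_hnorm_defect DT'P) !(sqr_hnorm_defect DXP).
by rewrite TX Tiso//; ring.
Qed.

Let M_lin (a : R[i]) x y : M x -> M y -> M (a *: x + y).
Proof.
rewrite ME => -[u _ <-] [v _ <-]; exists (a *: u + v) => //=.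
by rewrite Tlin (defect_linear DXP).
Qed.

Let M0 : M 0.
Proof.
rewrite ME; exists 0 => //=.
have T0 : T 0 = 0 := iter_lin0 Tlin 1.
by rewrite T0; exact: (iter_lin0 (defect_linear DXP) 1).
Qed.

Let wb_M_rinner x y : M x -> M y -> rinner (wb x) (wb y) = rinner x y.
Proof.
move=> Mx My; have Mxy : M (x + y) by rewrite -[x]scale1r; exact: M_lin.
have n2 : (2 : R) != 0 by [].
apply: (mulfI n2); rewrite !rinner_polar.
by rewrite -(linear_onD wb_lin) ?wb_M_iso//; exact: MD.
Qed.

Let orth_M x : (forall m, M m -> rinner x m = 0) -> orth M x.
Proof.
apply: orth_rinner => m Mm; rewrite -[_ *: _]addr0.
exact: M_lin.
Qed.

Let wb_orth_M x : D x -> orth M x -> wb x = 0.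
Proof. by case: wbP => _ _; exact. Qed.

(** As [wb] preserves inner products on [M], the vector [x = wbs (wb m) - m] is orthogonal to [M],
    hence [wb x = 0]; then [|x|^2 = <wb m, wb x> - <m, x> = 0]. *)
Let wbs_wb_M m : M m -> wbs (wb m) = m.
Proof.
move=> Mm; have Dm := MD Mm; set x := wbs (wb m) - m.
have Dx : D x by apply: (subspaceB Dsub) => //; exact/wbsD/wbD.
have xM m' : M m' -> rinner x m' = 0.
  move=> Mm'; rewrite rinnerBl rinnerC -wb_adj; [|exact: MD|exact: wbD].
  by rewrite wb_M_rinner// (rinnerC m') subrr.
have : rinner x x = 0.
  rewrite {1}/x rinnerBl rinnerC -wb_adj//; last exact: wbD.
  rewrite wb_orth_M ?(rinnerC m) ?xM//; first by rewrite rinner0l subrr.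
  exact: orth_M.
move/eqP; rewrite -sqr_hnorm sqrf_eq0 hnorm_eq0 subr_eq0 => /eqP; exact.
Qed.

Let rest x := x - wbs (wb x).

Let rest_lin (a : R[i]) x y : D x -> D y -> rest (a *: x + y) = a *: rest x + rest y.
Proof.
move=> Dx Dy; rewrite /rest wb_lin// wbs_lin; [|exact: wbD|exact: wbD].
by rewrite opprD addrACA scalerBr.
Qed.

(** For [m] in [M], [<wbs (wb x), m> = <x, wbs (wb m)> = <x, m>], so [rest x] is orthogonal to
    [M]. *)
Let rest_ker x : D x -> ker_wb (rest x).
Proof.
move=> Dx; have Dr : D (rest x) by apply: (subspaceB Dsub) => //; exact/wbsD/wbD.
split=> //; apply: wb_orth_M => //; apply: orth_M => m Mm.
have Dm := MD Mm.
rewrite rinnerBl [X in _ - X]rinnerC -wb_adj//; last exact: wbD.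
by rewrite [X in _ - X]rinnerC wb_adj ?wbs_wb_M ?subrr//; exact: wbD.
Qed.

Let R0_ker x : ker_wb x -> ker_wbs (R0 x). Proof. by case: R0P => + _ _; exact. Qed.

Let ker0 : ker_wb 0.
Proof. by split; [exact: subspace0|exact: (linear_on0 Dsub wb_lin)]. Qed.

Let R00 : R0 0 = 0.
Proof.
have [_ Rl _] := R0P; have := Rl 1 _ _ ker0 ker0.
by rewrite scaler0 addr0 scale1r -[LHS]addr0 => /addrI.
Qed.

Let W x := wb x + R0 (rest x).

Let W_cod x : D x -> (E `*` D) (W x).
Proof.
move=> Dx; have [wE wD] := wbD Dx; have [[rE rD] _] := R0_ker (rest_ker Dx).
by split; [exact: (subspaceD Esub)|exact: (subspaceD Dsub)].
Qed.

Let W_lin (a : R[i]) (x y : H) : D x -> D y -> W (a *: x + y) = a *: W x + W y.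
Proof.
move=> Dx Dy; have [_ Rl _] := R0P.
rewrite /W rest_lin// wb_lin// Rl; [|exact: rest_ker|exact: rest_ker].
by rewrite scalerDr addrACA.
Qed.

Let W_iso : isometric_on D W.
Proof.
move=> x Dx; have kr := rest_ker Dx; have [[EDr wbs0]] := (R0_ker kr, kr).
move=> [Dr wb0].
have Dp : D (wbs (wb x)) by exact/wbsD/wbD.
apply/eqP; rewrite -(@eqrXn2 _ 2) ?hnorm_ge0//; apply/eqP.
have xe : x = wbs (wb x) + rest x by rewrite addrC subrK.
have pr : rinner (wbs (wb x)) (rest x) = 0.
  by rewrite rinnerC -wb_adj ?wb0 ?rinner0l//; exact: wbD.
rewrite hnorm_pythagoras; last first.
  by rewrite (wb_adj Dx EDr) wbs0 rinnerC rinner0l.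
(* [|wb x|^2 = <x, wbs (wb x)>], and the part [rest x] of [x] is orthogonal to [wbs (wb x)]. *)
have -> : hnorm (wb x) ^+ 2 = hnorm (wbs (wb x)) ^+ 2.
  rewrite !sqr_hnorm (wb_adj Dx (wbD Dx)) {1}xe rinnerDl.
  by rewrite [rinner (rest x) _]rinnerC pr addr0.
by rewrite (R0iso kr) [in RHS]xe (hnorm_pythagoras pr).
Qed.

Let W_DXT h : W (DX (T h)) = (DT' (X h), DX h).
Proof.
rewrite /W /rest wbs_wb_M ?subrr ?R00 ?addr0//.
by apply: subset_closure; exists h.
Qed.

(* [W] is the constant value of [W(z)]; it is isometric because [rest] is the
   projection onto [ker wb], where [R0] takes values orthogonal to the range of
   [wb]. *)
Lemma colligation_of_isometry : exists W,
  [/\ forall x, D x -> (E `*` D) (W x),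
      forall (a : R[i]) (x y : H), D x -> D y -> W (a *: x + y) = a *: W x + W y,
      isometric_on D W,
      forall h, W (DX (T h)) = (DT' (X h), DX h) &
      forall (z : disc R) x, schur_W wb wbs (fun=> R0) z x = W x].
Proof. by exists W; split. Qed.

End FreeSchurContraction.

Local Close Scope complex_scope.
Set Strict Implicit.
Unset Implicit Arguments.

(** * Norm and lifting properties of [Y] *)

Theorem proposition4p7 (R : realType) (H H' : hilbertType R)
    (T : {linear H -> H}) (T' : {linear H' -> H'}) (X : {linear H -> H'})
    (DT' : H' -> H') (DX : H -> H)
    (om wb : H -> H' * H) (wbs : H' * H -> H) (R0 : H -> H' * H) :
  let ker_wb := ker_on (range_closure DX) wb in
  let ker_wbs := ker_on (range_closure DT' `*` range_closure DX) wbs in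
  let Y := corresponding_lifting X DX wb wbs (fun=> R0) in
  contractive T' -> completely_nonunitary T' ->
  unilateral_shift T ->
  contractive X -> (forall h, T' (X h) = X (T h)) ->
  defect_operator T' DT' -> defect_operator X DX ->
  is_omega T X DT' DX om ->
  is_omega_bar T DT' DX om wb ->
  adjoint_on (range_closure DX) (range_closure DT' `*` range_closure DX) wb wbs ->
  dim_le ker_wb ker_wbs ->
  closed (range DX) -> closed (range (DX \o T)) ->
  bounded_operator ker_wb ker_wbs R0 -> isometric_on ker_wb R0 ->
  contractive_intertwining_lifting T' DT' T X Y /\
  (forall h, lifting_norm (Y h) = hnorm h).
Proof.
move=> ker_wb ker_wbs Y _ _ Tshift _ TX DT'P DXP omP wbP wbsP _ DXcl DXTcl R0P R0iso.
have Tlin (a : R[i]) (x y : H) : T (a *: x + y) = a *: T x + T y by rewrite linearP.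
have Xlin (a : R[i]) (x y : H) : X (a *: x + y) = a *: X x + X y by rewrite linearP.
have Tiso : isometric_on setT T by case: Tshift.
have [W [Wcod Wlin Wiso WDXT WE]] := colligation_of_isometry Tlin Tiso TX
  DT'P DXP omP wbP wbsP DXTcl R0P R0iso.
pose D := range_closure DX.
have Dsub : closed_subspace D := range_closure_defect DXP.
have Esub : closed_subspace (range_closure DT') := range_closure_defect DT'P.
have DE : D = range DX by rewrite /D /range_closure -(closure_id _).1.
have DXD h : D (DX h) by rewrite DE; exists h.
pose B x := (W x).2; pose A x := (W x).1.
have BD x : D x -> D (B x) by move=> /Wcod[].
have Blin (a : R[i]) (x y : H) : D x -> D y -> B (a *: x + y) = a *: B x + B y.
  by move=> Dx Dy; rewrite /B Wlin.
have Bc x : D x -> hnorm (B x) <= hnorm x.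
  move=> Dx; apply: hnorm_le_sqr; rewrite ?hnorm_ge0//.
  by rewrite -(Wiso x Dx) sqr_hnorm_pair lerDr sqr_ge0.
have [c c0 DXc] :=
  closed_range_bounded_below (defect_linear DXP) (defect_sym DXP) DXcl.
(* The defect operator is a contraction, hence [K = 1]; the relation [B D_X T = D_X] is the second
   component of [WDXT]. *)
have stable h e : 0 < e ->
    exists N, forall n, (N <= n)%N -> hnorm (iter n B (DX h)) < e.
  apply: (strongly_stable Dsub BD Blin Bc DXD (defect_linear DXP)
    (defect_sym DXP) (K := 1) ler01 _ c0 _ Tlin Tshift) => //.
  - by move=> x; rewrite mul1r; exact: hnorm_defect_le DXP x.
  - by move=> x Dx; apply: DXc; rewrite -DE.
  - by move=> x; rewrite /B WDXT.
have YE h : Y h = (X h, fun z => transfer_function (D := D) (W := W) z (DX h)).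
  rewrite /Y /corresponding_lifting; congr (_, _); apply/funext => z.
  rewrite /schur_Gamma WE /transfer_function /colligation_resolvent.
  congr (W (pinv_ _ _ _ _)).1.
  by apply/funext => g; rewrite WE.
have taylor h := transfer_function_taylor Dsub Wcod Wlin Wiso (DXD h).
have sum h := transfer_function_sum Wcod Wiso (DXD h) (stable h).
(* Stability gives the Hardy component the norm [|D_X h|], and [|X h|^2 + |D_X h|^2 = |h|^2]. *)
have YN h : lifting_norm (Y h) = hnorm h.
  rewrite YE /lifting_norm /= (hardy2_normE (taylor h)).
  rewrite (cvg_lim _ (sum h))// sqrtr_sqr ger0_norm ?hnorm_ge0//.
  rewrite (sqr_hnorm_defect DXP) addrC subrK sqrtr_sqr ger0_norm ?hnorm_ge0//.
split=> //; split => //.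
- move=> h; rewrite /lifting_space /hardy2 YE /=.
  exists (fun n => A (iter n B (DX h))); split; last exact: taylor.
    by move=> n; have [] := Wcod _ (iter_on BD n (DXD h)).
  by apply/cvg_ex; exists (hnorm (DX h) ^+ 2); exact: sum.
- move=> a h k; rewrite !YE Xlin; congr (_, _); apply/funext => z.
  by rewrite (defect_linear DXP) (transfer_function_linear Dsub Wcod Wlin Wiso).
- by move=> h; rewrite YN.
(* The first component of [WDXT], [A D_X T h = D_T' X h], is the constant term that the lifting
   adds. *)
- move=> h; rewrite !YE /isometric_lifting /= TX; congr (_, _).
  apply/funext => z.
  by rewrite (transfer_function_shift Dsub Wcod Wlin Wiso z (DXD (T h)) (DXD h))
    WDXT.
Qed.
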